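(* Let $k \geq 2$ and let $G$ be a graph with $\chi_{DP}(G) = k$. Then: (i) If $G$ is connected and every bad $(k-1)$-fold cover of $G$ is full, then $\chi_{DP}(G \square K_{1,t}) \leq k$ for every $t \in \mathbb{N}$ with $t < \frac{P_{DP}(G,k)}{k}$. (ii) If $G$ is $k$-critical, then $\chi_{DP}(G \square K_{1,t}) = k+1$ for every $t \in \mathbb{N}$ with $t \geq \frac{P(G,k)}{k}$.
   Context: All graphs are finite, simple and nonempty. A DP-cover of a graph $G$ is a pair $\mathcal{H}=(L,H)$ where $H$ is a graph and $L$ assigns to each $v\in V(G)$ a set $L(v)\subseteq V(H)$ such that the sets $L(v)$ are pairwise disjoint independent sets of $H$ whose union is $V(H)$, and for $u\neq v$, if there is an edge of $H$ between $L(u)$ and $L(v)$ then $uv\in E(G)$ and the set of edges of $H$ between $L(u)$ and $L(v)$ is a matching (not necessarily perfect). $\mathcal{H}$ is $k$-fold if $|L(v)|=k$ for all $v$. An $\mathcal{H}$-coloring of $G$ is an independent set $I$ of $H$ with $|I\cap L(v)|=1$ for every $v\in V(G)$. A $k$-fold cover is bad if $G$ has no $\mathcal{H}$-coloring, and full if for every edge $uv\in E(G)$ the edges of $H$ between $L(u)$ and $L(v)$ form a perfect matching. The DP-chromatic number $\chi_{DP}(G)$ is the least $k$ such that $G$ has an $\mathcal{H}$-coloring for every $k$-fold cover $\mathcal{H}$. $P_{DP}(G,k)$ (the DP color function) is the minimum, over all $k$-fold covers $\mathcal{H}$ of $G$, of the number of $\mathcal{H}$-colorings of $G$. $P(G,k)$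 is the chromatic polynomial, i.e. the number of proper colorings $V(G)\to[k]$. A graph is $k$-critical if its chromatic number is $k$ and every proper subgraph has chromatic number less than $k$. $G\square H$ denotes the Cartesian product: vertex set $V(G)\times V(H)$, with $(u,v)\sim(u',v')$ iff either $u=u'$ and $vv'\in E(H)$, or $v=v'$ and $uu'\in E(G)$. $K_{1,t}$ is the complete bipartite graph (star) with parts of sizes $1$ and $t$. *)

(* Defs.v *)
From mathcomp Require Import all_boot.
From mathcomp Require Import boolp.

Set Implicit Arguments.
Unset Strict Implicit.
Unset Printing Implicit Defensive.

(* Nonemptiness is not part of the structure, because the graph underlying a
   0-fold cover is empty; it is required separately of the graphs under study. *)
Record sgraph := SGraph {
  vertex :> finType;
  adj : rel vertex;
  adj_sym : symmetric adj;
  adj_irrefl : irreflexive adj }.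

Definition connected (G : sgraph) : Prop := forall x y : G, connect (@adj G) x y.

Definition independent (G : sgraph) (A : {set G}) : bool :=
  [forall x in A, forall y in A, ~~ adj x y].

Definition edges_between (G : sgraph) (A B : {set G}) : {set {set G}} :=
  [set [set p.1; p.2] | p in setX A B & adj p.1 p.2].

(* For a set M of edges, trivIset says that distinct edges are disjoint. *)
Definition matching (T : finType) (M : {set {set T}}) : bool := trivIset M.

Definition perfect_matching (T : finType) (A : {set T}) (M : {set {set T}}) : bool :=
  matching M && (cover M == A).

Section Chromatic.
Variable G : sgraph.

Definition proper_coloring (k : nat) (c : {ffun G -> 'I_k}) : bool :=
  [forall x, forall y, adj x y ==> (c x != c y)].

Definition chromatic_poly (k : nat) : nat :=
  #|[set c : {ffun G -> 'I_k} | proper_coloring c]|.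

Definition colorable (k : nat) : bool :=
  [exists c : {ffun G -> 'I_k}, proper_coloring c].

Lemma ex_colorable : exists k, colorable k.
Proof.
exists #|G|; apply/existsP; exists [ffun x => enum_rank x].
apply/forallP => x; apply/forallP => y; apply/implyP => xy.
rewrite !ffunE; apply: contraTneq xy => /enum_rank_inj ->.
by rewrite adj_irrefl.
Qed.

Definition chromatic_number : nat := ex_minn ex_colorable.

End Chromatic.

Record subgraph (G : sgraph) := Subgraph {
  sub_vertices : {set G};
  sub_adj : rel G;
  sub_adj_sym : symmetric sub_adj;
  sub_adjP : forall x y, sub_adj x y ->
    [/\ x \in sub_vertices, y \in sub_vertices & adj x y] }.

Section SubgraphGraph.
Variables (G : sgraph) (S : subgraph G).

Definition sub_vertex : finType := {x : G | x \in sub_vertices S}.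
Definition srel : rel sub_vertex := fun x y => sub_adj S (val x) (val y).

Lemma srel_sym : symmetric srel.
Proof. by move=> x y; exact: sub_adj_sym. Qed.

Lemma srel_irrefl : irreflexive srel.
Proof. by move=> x; apply/negP => /sub_adjP[_ _]; rewrite adj_irrefl. Qed.

Definition graph_of_subgraph : sgraph := SGraph srel_sym srel_irrefl.

Definition proper_subgraph : Prop :=
  ~ (sub_vertices S = setT /\ sub_adj S =2 @adj G).

End SubgraphGraph.

Definition critical (G : sgraph) (k : nat) : Prop :=
  chromatic_number G = k /\
  forall S : subgraph G, sub_vertices S != set0 -> proper_subgraph S ->
    chromatic_number (graph_of_subgraph S) < k.

Section CartesianProduct.
Variables G H : sgraph.

Definition crel : rel (G * H) := fun p q =>
  (p.1 == q.1) && adj p.2 q.2 || (p.2 == q.2) && adj p.1 q.1.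

Lemma crel_sym : symmetric crel.
Proof.
by move=> p q; rewrite /crel (adj_sym p.2) (adj_sym p.1) (eq_sym p.1) (eq_sym p.2).
Qed.

Lemma crel_irrefl : irreflexive crel.
Proof. by move=> p; rewrite /crel !adj_irrefl !andbF. Qed.

Definition cartesian_product : sgraph := SGraph crel_sym crel_irrefl.

End CartesianProduct.

Section CompleteBipartite.
Variables m n : nat.

Definition brel : rel ('I_m + 'I_n) := fun x y =>
  match x, y with inl _, inr _ | inr _, inl _ => true | _, _ => false end.

Lemma brel_sym : symmetric brel. Proof. by case=> ? []. Qed.

Lemma brel_irrefl : irreflexive brel. Proof. by case. Qed.

Definition complete_bipartite : sgraph := SGraph brel_sym brel_irrefl.

End CompleteBipartite.

Definition star (t : nat) : sgraph := complete_bipartite 1 t.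

Record dp_cover (G : sgraph) := DPCover {
  cover_graph : sgraph;
  lists : G -> {set cover_graph};
  lists_disjoint : forall u v, u != v -> [disjoint lists u & lists v];
  lists_independent : forall v, independent (lists v);
  lists_cover : \bigcup_v lists v = setT;
  cross_edges_adj : forall u v, u != v ->
    edges_between (lists u) (lists v) != set0 -> adj u v;
  cross_edges_matching : forall u v, u != v ->
    matching (edges_between (lists u) (lists v)) }.

Section DPColoring.
Variable G : sgraph.
Implicit Types (C : dp_cover G) (k : nat).

Definition kfold k C : Prop := forall v, #|lists C v| = k.

Definition dp_coloring C (I : {set cover_graph C}) : bool :=
  independent I && [forall v, #|I :&: lists C v| == 1].

Definition dp_colorings C : {set {set cover_graph C}} :=
  [set I | dp_coloring I].

Definition bad C : Prop := ~ exists I : {set cover_graph C}, dp_coloring I.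

Definition full C : Prop := forall u v, adj u v ->
  perfect_matching (lists C u :|: lists C v)
    (edges_between (lists C u) (lists C v)).

Definition dp_colorable k : Prop := forall C, kfold k C ->
  exists I : {set cover_graph C}, dp_coloring I.

Lemma cross_edge_unique C u v x y z : u != v -> x \in lists C u ->
  y \in lists C v -> z \in lists C v -> adj x y -> adj x z -> y = z.
Proof.
move=> uv xu yv zv xy xz; have /trivIsetP tI := cross_edges_matching C uv.
have mem w : w \in lists C v -> adj x w ->
    [set x; w] \in edges_between (lists C u) (lists C v).
  move=> wv xw; apply/imsetP; exists (x, w) => //.
  by rewrite inE in_setX xu wv.
have [E|ne] := eqVneq [set x; y] [set x; z].
  have: y \in [set x; z] by rewrite -E set22.
  rewrite !inE => /orP[/eqP yx|/eqP //].
  by move: xy; rewrite yx adj_irrefl.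
have /disjointFr/(_ (set21 x y)) := tI _ _ (mem y yv xy) (mem z zv xz) ne.
by rewrite set21.
Qed.

Lemma dp_colorable_card : dp_colorable #|G|.
Proof.
move=> C kC.
have L0 v : exists x, x \in lists C v.
  by apply/card_gt0P; rewrite kC; apply/card_gt0P; exists v.
suff [f fL fI] : exists2 f : G -> cover_graph C, forall v, f v \in lists C v &
    {in enum G &, forall u v, ~~ adj (f u) (f v)}.
  exists (f @: setT); apply/andP; split.
    apply/forall_inP => _ /imsetP[u _ ->]; apply/forall_inP => _ /imsetP[v _ ->].
    by apply: fI; rewrite mem_enum.
  apply/forallP => v; apply/cards1P; exists (f v); apply/setP => x.
  rewrite !inE; apply/andP/eqP => [[/imsetP[u _ ->] fu]|->]; last first.
    by split=> //; apply: imset_f.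
  have [->//|uv] := eqVneq u v.
  by have /disjointFr/(_ (fL u)) := lists_disjoint C uv; rewrite fu.
have: size (enum G) <= #|G| by rewrite cardE.
elim: (enum G) (enum_uniq G) => [|v s IHs] /=.
  by move=> _ _; exists (fun v => xchoose (L0 v)) => // v; apply: xchooseP.
case/andP=> vs /IHs{}IHs ltsG; have [f fL fI] := IHs (ltnW ltsG).
pose F := \bigcup_(u <- s) [set y in lists C v | adj (f u) y].
have cF : #|F| <= size s.
  rewrite /F; elim: s vs {F IHs fI ltsG} => [|u s IHs].
    by rewrite big_nil cards0.
  rewrite inE negb_or eq_sym => /andP[uv /IHs{}IHs].
  rewrite big_cons; apply: leq_trans (leq_card_setU _ _) _.
  rewrite /= -add1n leq_add //; apply/card_le1_eqP => y z.
  rewrite !inE => /andP[yv fy] /andP[zv fz].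
  by rewrite (cross_edge_unique uv (fL u) yv zv fy fz).
have /subsetPn[y yv yF] : ~~ (lists C v \subset F).
  apply/negP => /subset_leq_card; rewrite kC => leGF.
  by have := leq_trans ltsG (leq_trans leGF cF); rewrite ltnn.
have yf u : u \in s -> ~~ adj (f u) y.
  move=> us; apply: contra yF => fy; rewrite /F (big_rem u us) /=.
  by rewrite !inE yv fy.
exists (fun u => if u == v then y else f u).
  by move=> u; case: eqP => [->|].
move=> u w; rewrite !inE.
case: eqVneq => [_ _|_ /= us]; case: eqVneq => [_ _|_ /= ws].
- by rewrite adj_irrefl.
- by rewrite adj_sym yf.
- exact: yf.
- exact: fI.
Qed.

Lemma ex_dp_colorable : exists k, `[< dp_colorable k >].
Proof. by exists #|G|; apply/asboolP; exact: dp_colorable_card. Qed.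

Definition dp_chromatic_number : nat := ex_minn ex_dp_colorable.

Section EdgelessCover.
Variable k : nat.

Let T : finType := (G * 'I_k)%type.
Let E0 : sgraph :=
  @SGraph T (fun _ _ => false) (fun _ _ => erefl) (fun _ => erefl).
Let L0 (v : G) : {set E0} := [set p : T | p.1 == v].

Let L0_disjoint u v : u != v -> [disjoint L0 u & L0 v].
Proof.
move=> uv; apply/pred0P => p /=; rewrite !inE.
by case: eqP => //= ->; apply/negbTE.
Qed.

Let L0_independent v : independent (L0 v).
Proof. by apply/forall_inP => x _; apply/forall_inP. Qed.

Let L0_cover : \bigcup_v L0 v = setT.
Proof. by apply/setP => p; rewrite inE; apply/bigcupP; exists p.1; rewrite ?inE. Qed.

Let L0_edges u v : edges_between (L0 u) (L0 v) = set0.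
Proof. by apply/setP => e; rewrite inE; apply/imsetP => -[p]; rewrite inE andbF. Qed.

Let L0_adj u v : u != v -> edges_between (L0 u) (L0 v) != set0 -> adj u v.
Proof. by rewrite L0_edges eqxx. Qed.

Let L0_matching u v : u != v -> matching (edges_between (L0 u) (L0 v)).
Proof. by rewrite L0_edges => _; apply/trivIsetP => A B; rewrite inE. Qed.

Lemma ex_kfold : exists C, kfold k C.
Proof.
exists (DPCover L0_disjoint L0_independent L0_cover L0_adj L0_matching) => v /=.
have -> : L0 v = setX [set v] [set: 'I_k].
  by apply/setP => -[u i]; rewrite !inE andbT.
by rewrite cardsX cards1 mul1n cardsT card_ord.
Qed.

End EdgelessCover.

Lemma ex_dp_count k :
  exists n, `[< exists2 C, kfold k C & #|dp_colorings C| = n >].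
Proof.
have [C kC] := ex_kfold k.
by exists #|dp_colorings C|; apply/asboolP; exists C.
Qed.

Definition dp_color_function k : nat := ex_minn (ex_dp_count k).

End DPColoring.

(* Main.v *)
(* (i) Color the center copy of G first.  If a center coloring does not extend to
   a given leaf copy, the colors left there form a bad (k-1)-fold cover, which is
   full by assumption; fullness and connectedness make such a coloring determined
   by its value at one vertex.  So each leaf blocks at most k center colorings, and
   t * k < P_DP(G, k) leaves one that extends everywhere.
   (ii) Put identity matchings on every copy of G, and match color i at the center
   to color i - r_j(v) at leaf j, where r_j ranges over representatives of the
   P(G, k) / k orbits of proper colorings under cyclic shifts.  The center coloring
   r_j + s then deletes the color s from all lists at leaf j, and G has no proper
   (k-1)-coloring. *)

Require Import Defs.
From mathcomp Require Import all_boot all_order all_algebra.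
From mathcomp Require Import boolp.

Set Implicit Arguments.
Unset Strict Implicit.
Unset Printing Implicit Defensive.

(** * Covers with lists indexed by ['I_k], and the covers left after deleting one color per
    vertex *)

Section IndexedCovers.
Variable G : sgraph.
Implicit Types k : nat.

(* A k-fold cover up to renaming of colors: [e u v i j] says that color [i] at [u]
   is joined to color [j] at [v]. *)
Definition matching_family k (e : G -> G -> rel 'I_k) : Prop :=
  [/\ forall u v i j, e u v i j = e v u j i,
      forall u v i j, e u v i j -> adj u v &
      forall u v i j j', e u v i j -> e u v i j' -> j = j'].

Definition avoids k (e : G -> G -> rel 'I_k) (c : {ffun G -> 'I_k}) : bool :=
  [forall u, forall v, ~~ e u v (c u) (c v)].

Lemma avoidsP k (e : G -> G -> rel 'I_k) (c : {ffun G -> 'I_k}) :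
  reflect (forall u v, ~~ e u v (c u) (c v)) (avoids e c).
Proof. by apply: (iffP forallP) => h u; have /forallP := h u. Qed.

Section CoverOfFamily.
Variables (k : nat) (e : G -> G -> rel 'I_k).
Hypothesis e_family : matching_family e.

Definition family_vertex : finType := (G * 'I_k)%type.
Definition family_rel : rel family_vertex := fun p q => e p.1 q.1 p.2 q.2.

Lemma family_rel_sym : symmetric family_rel.
Proof. by case: e_family => es _ _ p q; apply: es. Qed.

Lemma family_rel_irrefl : irreflexive family_rel.
Proof.
by case: e_family => _ ea _ p; apply/negP => /ea; rewrite adj_irrefl.
Qed.

Definition family_graph := SGraph family_rel_sym family_rel_irrefl.
Definition family_list (v : G) : {set family_graph} :=
  [set p : family_vertex | p.1 == v].

Lemma family_list_disjoint u v :
  u != v -> [disjoint family_list u & family_list v].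
Proof.
move=> uv; apply/pred0P => p /=; rewrite !inE.
by case: eqP => //= ->; apply/negbTE.
Qed.

Lemma family_list_independent v : independent (family_list v).
Proof.
apply/forall_inP => x; rewrite inE => /eqP xv.
apply/forall_inP => y; rewrite inE => /eqP yv.
case: e_family => _ ea _; apply/negP => /ea.
by rewrite xv yv adj_irrefl.
Qed.

Lemma family_list_cover : \bigcup_v family_list v = setT.
Proof. by apply/setP => p; rewrite inE; apply/bigcupP; exists p.1; rewrite ?inE. Qed.

Lemma family_edgesP u v A :
  reflect (exists i j, e u v i j /\ A = [set ((u, i) : family_graph); (v, j)])
    (A \in edges_between (family_list u) (family_list v)).
Proof.
apply: (iffP imsetP) => [[[[u1 i] [v1 j]]]|[i [j [eij ->]]]].
  by rewrite !inE /= => /andP[/andP[/eqP-> /eqP->] h] ->; exists i, j.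
by exists ((u, i), (v, j)) => //; rewrite !inE /= !eqxx.
Qed.

Lemma family_cross_adj u v : u != v ->
  edges_between (family_list u) (family_list v) != set0 -> adj u v.
Proof.
move=> _ /set0Pn[A /family_edgesP[i [j [eij _]]]].
by case: e_family => _ ea _; apply: ea eij.
Qed.

Lemma family_cross_matching u v : u != v ->
  matching (edges_between (family_list u) (family_list v)).
Proof.
move=> uv; case: e_family => es _ em; apply/trivIsetP => A B.
move=> /family_edgesP[i [j [eij ->]]] /family_edgesP[i' [j' [eij' ->]]] neAB.
rewrite disjoints_subset; apply/subsetP => p pA; rewrite inE.
apply: contra neAB => pB; apply/eqP.
have [ii|ii] := eqVneq i i'.
  by subst i'; rewrite (em _ _ _ _ _ eij eij').
have [jj|jj] := eqVneq j j'.
  subst j'; case/negP: ii; apply/eqP.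
  by apply: (em v u j); rewrite es.
move: pA pB; rewrite !inE => /orP[]/eqP->; rewrite !xpair_eqE /=.
  by rewrite eqxx (negbTE uv) /= orbF (negbTE ii).
by rewrite eqxx eq_sym (negbTE uv) /= (negbTE jj).
Qed.

Definition cover_of_family : dp_cover G :=
  DPCover family_list_disjoint family_list_independent family_list_cover
    family_cross_adj family_cross_matching.

Lemma kfold_cover_of_family : kfold k cover_of_family.
Proof.
move=> v; have -> : lists cover_of_family v = setX [set v] [set: 'I_k].
  by apply/setP => -[u i]; rewrite !inE andbT.
by rewrite cardsX cards1 mul1n cardsT card_ord.
Qed.

(** Since [I] meets each list in exactly one pair, it is the graph of a function. *)
Lemma coloring_cover_of_family (I : {set cover_graph cover_of_family}) :
  dp_coloring I ->
  exists2 c, avoids e c & I = [set ((v, c v) : family_graph) | v : G].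
Proof.
case/andP => /forall_inP indI /forallP oneI.
have ex v : exists i, ((v, i) : family_graph) \in I.
  have /cards1P[[u i] E] := oneI v.
  have : ((u, i) : family_graph) \in I :&: lists cover_of_family v.
    by rewrite E set11.
  by rewrite !inE /= => /andP[uI /eqP <-]; exists i.
pose c := [ffun v => xchoose (ex v)].
have cI v : ((v, c v) : family_graph) \in I.
  by rewrite ffunE; apply: (xchooseP (ex v)).
exists c.
  apply/avoidsP => u v.
  by have /forall_inP/(_ _ (cI v)) := indI _ (cI u).
apply/setP => -[v i]; apply/idP/imsetP => [viI|[u _ ->]]; last exact: cI.
exists v => //.
have /cards1P[p E] := oneI v.
have : ((v, i) : family_graph) \in I :&: lists cover_of_family v.
  by rewrite !inE viI /=.
have : ((v, c v) : family_graph) \in I :&: lists cover_of_family v.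
  by rewrite !inE cI /=.
by rewrite E => /set1P-> /set1P.
Qed.

Lemma bad_cover_of_family :
  (forall c, ~~ avoids e c) -> bad cover_of_family.
Proof. by move=> ne [I /coloring_cover_of_family[c]]; rewrite (negbTE (ne c)). Qed.

Lemma dp_color_function_le : dp_color_function G k <= #|[set c | avoids e c]|.
Proof.
rewrite /dp_color_function; case: ex_minnP => m _ /(_ #|dp_colorings cover_of_family|) le_m.
apply: leq_trans (le_m _) _.
  by apply/asboolP; exists cover_of_family => //; apply: kfold_cover_of_family.
pose g (c : {ffun G -> 'I_k}) : {set family_graph} :=
  [set ((v, c v) : family_graph) | v : G].
apply: leq_trans (leq_imset_card g _); apply/subset_leq_card/subsetP => I.
rewrite inE => /coloring_cover_of_family[c ac ->].
by apply/imsetP; exists c; rewrite ?inE.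
Qed.

Lemma full_cover_of_family u v i : full cover_of_family -> adj u v ->
  exists j, e u v i j.
Proof.
move=> fullC /fullC /andP[_ /eqP cov].
have : ((u, i) : family_graph) \in
    cover (edges_between (family_list u) (family_list v)).
  by rewrite cov !inE eqxx.
case/bigcupP => A /family_edgesP[i' [j [eij ->]]].
rewrite !inE => /orP[]/eqP[].
  by move=> ->; exists j.
(* The covering edge cannot have [(u, i)] as its end in the list of [v]: that would force
   [u = v]. *)
by move=> uv _; case: e_family => _ /(_ _ _ _ _ eij); rewrite uv adj_irrefl.
Qed.

End CoverOfFamily.

(** Enumerating the lists of an arbitrary [k]-fold cover identifies each with ['I_k], so families
    represent all covers. *)
Lemma dp_colorableP k : dp_colorable G k <->
  forall e : G -> G -> rel 'I_k, matching_family e -> exists c, avoids e c.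
Proof.
split=> [colG e fe|famG C kC].
  have [I /coloring_cover_of_family[c]] := colG _ (kfold_cover_of_family fe).
  by exists c.
pose phi v (i : 'I_k) : cover_graph C := enum_val (cast_ord (esym (kC v)) i).
have phiL v i : phi v i \in lists C v by apply: enum_valP.
(* The conjunct [u != v] loses no edge, lists being independent. *)
pose e u v i j := (u != v) && adj (phi u i) (phi v j).
have fe : matching_family e.
  split=> [u v i j|u v i j /andP[uv eij]|u v i j j' /andP[uv a] /andP[_ b]].
  - by rewrite /e eq_sym adj_sym.
  - apply: (cross_edges_adj uv); apply/set0Pn; exists [set phi u i; phi v j].
    by apply/imsetP; exists (phi u i, phi v j); rewrite // !inE /= !phiL.
  - have := cross_edge_unique uv (phiL u i) (phiL v j) (phiL v j') a b.
    by move/enum_val_inj/cast_ord_inj.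
have [c /avoidsP ac] := famG e fe.
exists [set phi v (c v) | v : G]; apply/andP; split.
  apply/forall_inP => _ /imsetP[u _ ->]; apply/forall_inP => _ /imsetP[v _ ->].
  have [->|uv] := eqVneq u v; first by rewrite adj_irrefl.
  by have := ac u v; rewrite /e uv.
apply/forallP => v; apply/cards1P; exists (phi v (c v)); apply/setP => x.
rewrite !inE; apply/andP/eqP => [[/imsetP[u _ ->] uL]|->]; last first.
  by split; [apply: imset_f | apply: phiL].
have [->//|uv] := eqVneq u v.
by have /disjointFr/(_ (phiL u (c u))) := lists_disjoint C uv; rewrite uL.
Qed.

Lemma dp_colorableW m n : m <= n -> dp_colorable G m -> dp_colorable G n.
Proof.
move=> le_mn /dp_colorableP colG; apply/dp_colorableP => e [es ea em].
pose e' u v (i j : 'I_m) := e u v (widen_ord le_mn i) (widen_ord le_mn j).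
have fe' : matching_family e'.
  split=> [u v i j|u v i j|u v i j j' a b]; [exact: es|exact: ea|].
  by apply: val_inj; have /(congr1 val) := em _ _ _ _ _ a b.
have [c /avoidsP ac] := colG _ fe'.
exists [ffun v => widen_ord le_mn (c v)]; apply/avoidsP => u v.
by rewrite !ffunE; apply: ac.
Qed.

Lemma dp_chromatic_number_le k :
  (dp_chromatic_number G <= k) <-> dp_colorable G k.
Proof.
rewrite /dp_chromatic_number; case: ex_minnP => m /asboolP cm mmin.
split=> [le_mk|ck]; first exact: dp_colorableW cm.
by apply: mmin; apply/asboolP.
Qed.

(** The family left when color [f u] is deleted from each list; [lift] renumbers the [n] remaining
    colors. *)
Definition residual n (e : G -> G -> rel 'I_n.+1) (f : G -> 'I_n.+1) :
    G -> G -> rel 'I_n :=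
  fun u v i j => e u v (lift (f u) i) (lift (f v) j).

Lemma residual_family n (e : G -> G -> rel 'I_n.+1) f :
  matching_family e -> matching_family (residual e f).
Proof.
case=> es ea em; split=> [u v i j|u v i j|u v i j j' a b].
- exact: es.
- exact: ea.
- exact: lift_inj (em _ _ _ _ _ a b).
Qed.

Definition residual_bad n (e : G -> G -> rel 'I_n.+1) f :=
  [forall d, ~~ avoids (residual e f) d].

(* A bad residual cover is full, so the color deleted at a vertex is the unique
   color not matched to the colors kept at a given neighbor. *)
Lemma residual_bad_eq n (e : G -> G -> rel 'I_n.+1) f f' u v :
  (forall C : dp_cover G, kfold n C -> bad C -> full C) ->
  matching_family e -> residual_bad e f -> residual_bad e f' ->
  adj u v -> f u = f' u -> f v = f' v.
Proof.
move=> fullG fe /forallP bf /forallP bf' uv fu.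
have full_res g : (forall d, ~~ avoids (residual e g) d) -> forall x y i,
    adj x y -> exists j, residual e g x y i j.
  move=> bg x y i xy; apply: full_cover_of_family => //.
    exact: residual_family.
  move=> fg; apply: fullG; first exact: kfold_cover_of_family.
  exact: bad_cover_of_family.
have [//|] := eqVneq (f v) (f' v).
(* Otherwise [f' v] survives the deletion by [f], so it is joined to a kept color of [u]. That color
   is also kept under [f'], hence joined to some color other than [f' v], against the matching
   property. *)
case/unlift_some => i fi _.
have vu : adj v u by rewrite adj_sym.
have [j] := full_res f bf v u i vu.
rewrite /residual -fi fu => a.
have [i'] := full_res f' bf' u v j uv.
case: fe => es _ em; rewrite /residual => b; rewrite es in a.
by have /eqP := em _ _ _ _ _ a b; rewrite (negbTE (neq_lift _ _)).
Qed.

End IndexedCovers.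

(** * Extending a center coloring to the leaf copies *)

Section StarProduct.
Variables (G : sgraph) (t n : nat).
Variable e : cartesian_product G (star t) -> cartesian_product G (star t) ->
  rel 'I_n.+1.
Hypothesis fe : matching_family e.

Definition center (v : G) : cartesian_product G (star t) := (v, inl ord0).
Definition leaf (j : 'I_t) (v : G) : cartesian_product G (star t) := (v, inr j).

Definition center_family u v := e (center u) (center v).
Definition leaf_family j u v := e (leaf j u) (leaf j v).

Lemma center_matching_family : matching_family center_family.
Proof.
case: fe => es ea em; split=> [u v i l|u v i l /ea|u v i l l'].
- exact: es.
- by rewrite /= /crel /= andbF.
- exact: em.
Qed.

Lemma leaf_matching_family j : matching_family (leaf_family j).
Proof.
case: fe => es ea em; split=> [u v i l|u v i l /ea|u v i l l'].
- exact: es.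
- by rewrite /= /crel /= andbF eqxx.
- exact: em.
Qed.

Definition extends j (c d : {ffun G -> 'I_n.+1}) : bool :=
  avoids (leaf_family j) d &&
  [forall v, ~~ e (center v) (leaf j v) (c v) (d v)].

Definition blocked j (c : {ffun G -> 'I_n.+1}) : bool :=
  [forall d, ~~ extends j c d].

(** Distinct leaves are nonadjacent, so extensions chosen leaf by leaf can be glued. *)
Lemma star_extension (c : {ffun G -> 'I_n.+1}) : avoids center_family c ->
  (forall j, ~~ blocked j c) -> exists c', avoids e c'.
Proof.
move=> /avoidsP ac good.
have ex j : exists d, extends j c d.
  by have /forallPn[d] := good j; rewrite negbK => h; exists d.
pose d j := xchoose (ex j).
have dP j u v : ~~ e (leaf j u) (leaf j v) (d j u) (d j v).
  by have /andP[/avoidsP h _] := xchooseP (ex j); apply: h.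
have dc j v : ~~ e (center v) (leaf j v) (c v) (d j v).
  by have /andP[_ /forallP h] := xchooseP (ex j); apply: h.
case: (fe) => es ea em.
exists [ffun p : cartesian_product G (star t) => match p.2 with
  | inl _ => c p.1 | inr j => d j p.1 end].
have cross u v j : ~~ e (center u) (leaf j v) (c u) (d j v).
  apply/negP => euv; have := ea _ _ _ _ euv.
  rewrite /= /crel /= andbT orbF => /eqP uv; rewrite uv in euv.
  by rewrite (negbTE (dc _ _)) in euv.
apply/avoidsP => -[u x] [v y]; rewrite !ffunE /=.
case: x y => [x|j] [y|l]; rewrite ?(ord1 x) ?(ord1 y).
- exact: ac.
- exact: cross.
- by rewrite es; apply: cross.
- have [->|jl] := eqVneq j l; first exact: dP.
  apply/negP => /ea; rewrite /= /crel /= andbF /=.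
  by case/andP => /eqP[] /eqP; rewrite (negbTE jl).
Qed.

(** Where [c v] is unmatched, [f v] is arbitrary; [card_blocked] exploits this freedom. *)
Definition deletes j (c : {ffun G -> 'I_n.+1}) (f : G -> 'I_n.+1) : Prop :=
  forall v l, e (center v) (leaf j v) (c v) l -> l = f v.

Definition deletion j (c : {ffun G -> 'I_n.+1}) (v : G) : 'I_n.+1 :=
  odflt ord0 [pick l | e (center v) (leaf j v) (c v) l].

Lemma deletionP j c : deletes j c (deletion j c).
Proof.
case: fe => _ _ em v l el; rewrite /deletion; case: pickP => [l' el'|/(_ l)].
  exact: em el el'.
by rewrite el.
Qed.

(** A coloring of the residual family, lifted past [f], would extend [c] to leaf [j]. *)
Lemma blocked_residual j c f :
  deletes j c f -> blocked j c -> residual_bad (leaf_family j) f.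
Proof.
move=> cf /forallP bc; apply/forallP => d; apply/negP => /avoidsP ad.
case/negP: (bc [ffun v => lift (f v) (d v)]); apply/andP; split.
  by apply/avoidsP => u v; rewrite !ffunE; apply: ad.
apply/forallP => v; apply/negP; rewrite ffunE => /cf/eqP.
by rewrite eq_sym (negbTE (neq_lift _ _)).
Qed.

End StarProduct.

(** * Counting the center colorings blocked by one leaf *)

Lemma connected_neighbor (G : sgraph) : connected G ->
  1 < dp_chromatic_number G -> forall v : G, exists u, adj u v.
Proof.
move=> conG; rewrite ltnNge => /negP chiG v.
apply: contrapT => nov; apply: chiG; apply/dp_chromatic_number_le.
(* A vertex without neighbors is all of a connected graph, and then one color suffices. *)
have allv x : x = v.
  have /connectP[[|y p] /=] := conG v x; first by [].
  by case/andP => vy _ _; case: nov; exists y; rewrite adj_sym.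
apply/dp_colorableP => e [_ ea _]; exists [ffun => ord0]; apply/avoidsP => x y.
by apply/negP => /ea; rewrite (allv x) (allv y) adj_irrefl.
Qed.

(* Blocked center colorings agreeing at one vertex are equal: the deleted colors
   propagate along edges, and each determines the center color it is matched to. *)
Lemma card_blocked (G : sgraph) t n
    (e : cartesian_product G (star t) -> cartesian_product G (star t) ->
      rel 'I_n.+2) j :
  0 < #|G| -> connected G -> 1 < dp_chromatic_number G ->
  (forall C : dp_cover G, kfold n.+1 C -> bad C -> full C) ->
  matching_family e -> #|[set c | blocked e j c]| <= n.+2.
Proof.
move=> /card_gt0P[v0 _] conG chiG fullG fe; set B := [set c | _].
have fj := leaf_matching_family fe j.
have step c c' f f' u v : c \in B -> c' \in B -> deletes e j c f ->
    deletes e j c' f' -> adj u v -> f u = f' u -> f v = f' v.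
  rewrite !inE => bc bc' cf cf'.
  by apply: residual_bad_eq fullG fj _ _; apply: blocked_residual;
    first [exact: cf | exact: cf' | by []].
have matched c v : c \in B ->
    e (center t v) (leaf j v) (c v) (deletion e j c v).
  move=> cB; have df := deletionP fe (j := j) (c := c).
  have [l el|none] := pickP (fun l => e (center t v) (leaf j v) (c v) l).
    by rewrite -(df _ _ el).
  have [u uv] := connected_neighbor conG chiG v.
  have uv' : u != v by apply: contraTneq uv => ->; rewrite adj_irrefl.
  (* Were [c v] unmatched, the color deleted at [v] could be changed freely; but the unchanged color
     at the neighbor [u] determines it. *)
  pose f' w := if w == v then lift (deletion e j c v) ord0 else deletion e j c w.
  have df' : deletes e j c f'.
    move=> w l; rewrite /f'; case: eqP => [->|_]; last exact: df.
    by rewrite none.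
  have := step _ _ _ _ u v cB cB df df' uv.
  rewrite /f' eqxx (negbTE uv') => /(_ erefl)/eqP.
  by rewrite (negbTE (neq_lift _ _)).
have inj : {in B &, injective (fun c : {ffun G -> 'I_n.+2} => c v0)}.
  move=> c c' cB cB' c0; apply/ffunP => v.
  have /connectP[p pP ->] := conG v0 v.
  elim: p v0 c0 pP => [|w p IHp] u cu //= /andP[uw /IHp]; apply.
  have du : deletion e j c u = deletion e j c' u by rewrite /deletion cu.
  have := step _ _ _ _ _ _ cB cB' (deletionP fe (c := c))
    (deletionP fe (c := c')) uw du.
  have := matched c w cB; have := matched c' w cB'.
  case: fe => es _ em; rewrite es => m' m d; rewrite es d in m.
  exact: em m m'.
rewrite -(card_in_imset inj) -[X in _ <= X]card_ord; exact: max_card.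
Qed.

(** * Upper bounds for the product with a star *)

Lemma star_product_colorable (G : sgraph) t k :
  0 < #|G| -> connected G -> 1 < k -> 1 < dp_chromatic_number G ->
  (forall C : dp_cover G, kfold k.-1 C -> bad C -> full C) ->
  t * k < dp_color_function G k ->
  dp_colorable (cartesian_product G (star t)) k.
Proof.
case: k => [|[|n]] //= G0 conG _ chiG fullG ltP.
apply/dp_colorableP => e fe.
have [c ac nc] : exists2 c, avoids (center_family e) c &
    c \notin \bigcup_(j < t) [set c | blocked e j c].
  have ltB : #|\bigcup_(j < t) [set c | blocked e j c]| <
      #|[set c | avoids (center_family e) c]|.
    apply: leq_ltn_trans (leq_trans ltP _); last first.
      exact: dp_color_function_le (center_matching_family fe).
    (* Union bound: [t * k] is read as a sum of [k] over the leaves. *)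
    rewrite -[t in t * _]card_ord -sum_nat_const.
    elim/big_rec2: _ => [|j m A _ le_m]; first by rewrite cards0.
    apply: leq_trans (leq_card_setU _ _) _; apply: leq_add le_m.
    exact: card_blocked.
  have /subsetPn[c] : ~~ ([set c | avoids (center_family e) c] \subset
      \bigcup_(j < t) [set c | blocked e j c]).
    by apply: contraL ltB => /subset_leq_card; rewrite -leqNgt.
  by rewrite inE; exists c.
apply: (star_extension fe ac) => j; apply: contra nc => bc.
by apply/bigcupP; exists j; rewrite ?inE.
Qed.

(** Once the center is colored, each leaf list loses at most one of its [k.+1] colors, and [k] are
    enough for [G]. *)
Lemma star_product_colorableS (G : sgraph) t k :
  dp_colorable G k -> dp_colorable (cartesian_product G (star t)) k.+1.
Proof.
move=> colG; apply/dp_colorableP => e fe.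
have [c ac] : exists c, avoids (center_family e) c.
  have /dp_colorableP := dp_colorableW (leqnSn k) colG; apply.
  exact: center_matching_family.
apply: (star_extension fe ac) => j; apply/negP.
move=> /(blocked_residual (deletionP fe (c := c)))/forallP bc.
have fr := residual_family (deletion e j c) (leaf_matching_family fe j).
have /dp_colorableP/(_ _ fr)[d] := colG.
by rewrite (negbTE (bc d)).
Qed.

(** * A bad cover of the product built from cyclic shifts *)

Section BadStarCover.
Import GRing.Theory.
Local Open Scope ring_scope.
Variables (G : sgraph) (t n : nat).
Local Notation color := 'I_n.+2.
Variable r : 'I_t -> {ffun G -> color}.

(** Subtraction is that of the integers modulo [n.+2]; the center color [r b v + s] is joined to [s]
    at leaf [b], for every [v]. *)
Definition shift_matching (u v : cartesian_product G (star t)) : rel color :=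
  fun i j => match u.2, v.2 with
  | inl _, inl _ => adj u.1 v.1 && (i == j)
  | inr a, inr b => [&& a == b, adj u.1 v.1 & i == j]
  | inl _, inr b => (u.1 == v.1) && (j == i - r b u.1)
  | inr a, inl _ => (u.1 == v.1) && (i == j - r a u.1)
  end.

Lemma shift_matching_family : matching_family shift_matching.
Proof.
split=> [[u x] [v y] i j|[u x] [v y] i j|[u x] [v y] i j j'];
  rewrite /shift_matching /=.
- case: x y => [x|x] [y|y].
  + by rewrite adj_sym eq_sym.
  + by rewrite eq_sym; case: eqP => // ->.
  + by rewrite eq_sym; case: eqP => // ->.
  + by rewrite adj_sym (eq_sym x) (eq_sym i).
- rewrite /crel /=; case: x y => [x|x] [y|y].
  + by rewrite (ord1 x) (ord1 y) eqxx => /andP[-> _]; rewrite orbT.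
  + by case/andP => ->.
  + by case/andP => ->.
  + by case/and3P => /eqP-> -> _; rewrite eqxx orbT.
- case: x y => [x|x] [y|y].
  + by move=> /andP[_ /eqP<-] /andP[_ /eqP].
  + by move=> /andP[_ /eqP->] /andP[_ /eqP].
  + move=> /andP[_ /eqP->] /andP[_ /eqP].
    by move/addIr.
  + by move=> /and3P[_ _ /eqP<-] /and3P[_ _ /eqP].
Qed.

Definition shift (c : {ffun G -> color}) (s : color) : {ffun G -> color} :=
  [ffun v => c v + s].

Lemma proper_shift c s : proper_coloring (shift c s) = proper_coloring c.
Proof.
apply: eq_forallb => u; apply: eq_forallb => v.
by rewrite !ffunE (inj_eq (addIr s)).
Qed.

(* Over a center coloring [shift (r j) s], leaf [j] loses the color [s] at every
   vertex, and what remains is a proper coloring with one color fewer. *)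
Lemma shift_matching_bad : ~~ colorable G n.+1 ->
  (forall c : {ffun G -> color}, proper_coloring c ->
     exists j s, c = shift (r j) s) ->
  forall c, ~~ avoids shift_matching c.
Proof.
move=> ncol cov c; apply/negP => /avoidsP ac.
pose c0 := [ffun v => c (center t v)].
have pc0 : proper_coloring c0.
  apply/forallP => u; apply/forallP => v; apply/implyP => uv.
  by have := ac (center t u) (center t v); rewrite /shift_matching /= uv !ffunE.
have [j [s cE]] := cov _ pc0.
have avoid_s v : s != c (leaf j v).
  have := ac (center t v) (leaf j v); rewrite /shift_matching /= eqxx /=.
  by have /ffunP/(_ v) := cE; rewrite !ffunE => ->; rewrite addrC addKr eq_sym.
have ex v : exists i : 'I_n.+1, lift s i == c (leaf j v).
  by have [i -> _] := unlift_some (avoid_s v); exists i.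
case/negP: ncol; apply/existsP; exists [ffun v => xchoose (ex v)].
apply/forallP => u; apply/forallP => v; apply/implyP => uv.
rewrite !ffunE; apply/eqP => /(congr1 (lift s)).
rewrite (eqP (xchooseP (ex u))) (eqP (xchooseP (ex v))) => /eqP.
have := ac (leaf j u) (leaf j v); rewrite /shift_matching /= eqxx uv /=.
by move/negbTE->.
Qed.

End BadStarCover.

(* One representative per orbit of proper colorings under cyclic shifts is given
   by the colorings vanishing at a fixed vertex. *)
Lemma star_product_not_colorable (G : sgraph) t k : 0 < #|G| -> 1 < k ->
  ~~ colorable G k.-1 -> chromatic_poly G k <= t * k ->
  ~ dp_colorable (cartesian_product G (star t)) k.
Proof.
case: k => [|[|n]] //= /card_gt0P[v0 _] _ ncol leP /dp_colorableP colGt.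
pose R := [set c : {ffun G -> 'I_n.+2} | proper_coloring c && (c v0 == 0%R)].
have cardR : #|R| <= t.
  (* The [n.+2] shifts of the elements of [R] are distinct proper colorings: the value at [v0] gives
     the shift. *)
  rewrite -(leq_pmul2r (isT : 0 < n.+2)); apply: leq_trans leP.
  rewrite -[X in _ * X]card_ord -cardsT -cardsX /chromatic_poly.
  have inj : {in setX R [set: 'I_n.+2] &, injective (fun p => shift p.1 p.2)}.
    move=> [c s] [c' s']; rewrite !inE /= !andbT.
    move=> /andP[_ /eqP c0] /andP[_ /eqP c0'] /ffunP E.
    have := E v0; rewrite !ffunE c0 c0' !GRing.add0r => ss; congr (_, _) => //.
    apply/ffunP => v; have := E v; rewrite !ffunE ss.
    by move/GRing.addIr.
  rewrite -(card_in_imset inj); apply/subset_leq_card/subsetP => c.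
  case/imsetP => -[c' s]; rewrite !inE /= andbT => /andP[pc' _] ->.
  by rewrite proper_shift.
(* Leaves beyond [#|R|] receive the zero function, proper or not; it matters only that all of [R] is
   listed. *)
pose r (j : 'I_t) := nth [ffun => 0%R] (enum R) j.
have [c] := colGt _ (shift_matching_family r).
apply/negP; apply: shift_matching_bad ncol _ c => c pc.
(* Shifting the value at [v0] to zero gives the representative of [c]. *)
pose c' := shift c (- c v0)%R.
have c'R : c' \in R by rewrite inE proper_shift pc ffunE GRing.subrr eqxx.
have lt_t : index c' (enum R) < t.
  by apply: leq_trans cardR; rewrite cardE index_mem mem_enum.
exists (Ordinal lt_t), (c v0); apply/ffunP => v.
by rewrite ffunE /r nth_index ?mem_enum // ffunE GRing.subrK.
Qed.

(** * From rational bounds to inequalities between naturals, and both conclusions *)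

Theorem theorem1p7 (k : nat) (G : sgraph) (hk : 2 <= k) (hG : 0 < #|G|)
    (hGk : dp_chromatic_number G = k) :
  (connected G ->
   (forall C : dp_cover G, kfold k.-1 C -> bad C -> full C) ->
   forall t : nat,
     (t%:R < (dp_color_function G k)%:R / k%:R :> rat)%R ->
     dp_chromatic_number (cartesian_product G (star t)) <= k)
  /\
  (critical G k ->
   forall t : nat,
     ((chromatic_poly G k)%:R / k%:R <= t%:R :> rat)%R ->
     dp_chromatic_number (cartesian_product G (star t)) = k.+1).
Proof.
have k0 : (0 < k%:R :> rat)%R by rewrite Num.Theory.ltr0n; apply: leq_trans hk.
split=> [conG fullG t|[chiG _] t].
  rewrite Num.Theory.ltr_pdivlMr // -GRing.natrM Num.Theory.ltr_nat => ltP.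
  apply/dp_chromatic_number_le.
  by apply: star_product_colorable; rewrite ?hGk.
rewrite Num.Theory.ler_pdivrMr // -GRing.natrM Num.Theory.ler_nat => leP.
apply/eqP; rewrite eqn_leq; apply/andP; split.
  apply/dp_chromatic_number_le/star_product_colorableS.
  by apply/dp_chromatic_number_le; rewrite hGk.
rewrite ltnNge; apply/negP => /dp_chromatic_number_le.
apply: star_product_not_colorable => //; apply/negP => colk.
(* A coloring with [k.-1] colors would contradict chromatic number [k]. *)
have : chromatic_number G <= k.-1.
  by rewrite /chromatic_number; case: ex_minnP => m _; apply.
by rewrite chiG; case: (k) hk => [|m] //=; rewrite ltnn.
Qed.
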